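(* Let $k$ be a field of characteristic zero and let $f\in k[x,y,z]$. If $f$ is a coordinate in $k[x,y,z]$ and $f$ is also a $k(z)$-coordinate (i.e. a coordinate of $k(z)[x,y]$), then $f$ is a $k[z]$-coordinate (i.e. a coordinate of $k[z][x,y]$).
   Context: For a commutative ring $S$ and $n\ge 1$, a polynomial $g\in S[x_1,\ldots,x_n]$ is called a coordinate (or $S$-coordinate) of $S[x_1,\ldots,x_n]$ if there exist $g_2,\ldots,g_n$ such that the $S$-algebra endomorphism sending $x_1\mapsto g$, $x_i\mapsto g_i$ ($2\le i\le n$) is an automorphism. Here $k(z)$ is the field of rational functions in $z$ and $k[x,y,z]=k[z][x,y]\subset k(z)[x,y]$. *)

(* Defs.v *)
From mathcomp Require Import all_boot all_algebra.
From mathcomp Require Export mpoly.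

Set Implicit Arguments.
Unset Strict Implicit.
Unset Printing Implicit Defensive.

Import GRing.Theory.
Local Open Scope ring_scope.

(* [p \mPo lq] is the S-algebra endomorphism 'X_i |-> lq`_i applied to p.  The
   number of variables is n.+1, so that it is at least 1. *)
Definition coordinate (S : comNzRingType) (n : nat) (f : {mpoly S[n.+1]}) : Prop :=
  exists g : n.-tuple {mpoly S[n.+1]},
    bijective (fun p : {mpoly S[n.+1]} => p \mPo [tuple of f :: g]).

(* The identification k[x,y,z] = k[z][x,y], where 'X_0, 'X_1, 'X_2 on the left
   are x, y, z; on the right 'X_0, 'X_1 are x, y, and z is the indeterminate of
   {poly k}. *)
Definition poly_xyz_z_xy (k : fieldType) : {mpoly k[3]} -> {mpoly {poly k}[2]} :=
  mmap (@mpolyC 2 {poly k} \o polyC)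
       (tnth [tuple 'X_0; 'X_1; ('X : {poly k})%:MP]).

(* The inclusion of k[z][x,y] into k(z)[x,y]. *)
Definition poly_z_xy_frac (k : fieldType) :
    {mpoly {poly k}[2]} -> {mpoly {fraction {poly k}}[2]} :=
  map_mpoly (@tofrac {poly k}).

(* Main.v *)
Require Import Defs.
From HB Require Import structures.
From mathcomp Require Import all_boot all_algebra all_field generic_quotient.
From mathcomp Require Import mpoly.
From Stdlib Require Import Classical.

Set Implicit Arguments.
Unset Strict Implicit.
Unset Printing Implicit Defensive.

Import GRing.Theory.
Local Open Scope ring_scope.

(** The idea is to start from a second coordinate p of f over k(z), with
    denominators cleared, and to improve it until it is a coordinate over k[z].
    Let d in k[z] be such that d x and d y are polynomials in f and p over
    k[z].  If d is constant, then f and p generate k[z][x,y], and we are done.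
    Otherwise let pi be an irreducible factor of d.  Modulo pi, either d x and
    d y give relations that are divisible by pi, and d can be divided by pi, or
    f and p become algebraically dependent.  In the second case p is, modulo pi,
    a polynomial h in f; then p' = (p - h(f)) / pi replaces p, and again d can be
    divided by pi ([divide_denominator]).

    That p is a polynomial in f modulo pi rests on one geometric fact
    ([fibre_prime]): for alpha algebraic over k, the polynomial f(x,y,alpha) is
    nonconstant and remains irreducible over every finite extension L of k
    containing alpha.  Given a relation between f and p modulo pi, f then
    divides a nonzero polynomial in p alone, hence some p - c with c constant,
    and one concludes by induction on the degree ([dependent_polynomial]).

    For the geometric fact, use that f is a coordinate of L[x,y,z], so that
    B = L[x,y,z]/(f) is a polynomial ring in two variables: a factorial ring
    whose units are constants.  Since f is a coordinate over k(z), the ring B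
    becomes L[z,1/d][p] after inverting d.  A factorization of z - alpha in B is
    thus a factorization in L(z), and the two properties of B force it to be
    trivial; so z - alpha is prime in B, and B/(z - alpha) is the quotient of
    L[x,y] by f(x,y,alpha).

    Statements over L descend to k along a linear retraction of L onto k
    ([retraction]). *)

(** * Evaluation morphisms and congruences *)

Definition dvdr (R : comNzRingType) (a b : R) : Prop := exists c, b = a * c.

(** This is Euclid's property alone, so units have it too. *)
Definition prime_elt (R : comNzRingType) (f : R) : Prop :=
  forall a b, dvdr f (a * b) -> dvdr f a \/ dvdr f b.

Lemma poly_ring_ind (R : comNzRingType) (P : {poly R} -> Prop) :
    (forall c, P c%:P) -> P 'X ->
    (forall p q, P p -> P q -> P (p + q)) ->
    (forall p q, P p -> P q -> P (p * q)) ->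
  forall p, P p.
Proof.
move=> PC PX PD PM; elim/poly_ind => [|p c IHp]; first by rewrite -polyC0.
by apply: (PD) => //; apply: (PM).
Qed.

Lemma mpoly_ring_ind (R : comNzRingType) (n : nat) (P : {mpoly R[n]} -> Prop) :
    (forall c, P c%:MP) -> (forall i, P 'X_i) ->
    (forall p q, P p -> P q -> P (p + q)) ->
    (forall p q, P p -> P q -> P (p * q)) ->
  forall p, P p.
Proof.
move=> PC PX PD PM; elim/mpolyind => [|c m p _ _ IHp]; first by rewrite -mpolyC0.
apply: (PD) => //; rewrite -mul_mpolyC; apply: (PM) => //.
rewrite mpolyXE_id; elim/big_rec: _ => [|i q _ Pq]; first by rewrite -mpolyC1.
apply: (PM) => //; elim: (m i) => [|j IHj]; first by rewrite expr0 -mpolyC1.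
by rewrite exprS; apply: (PM).
Qed.

Lemma poly_rmorph_eq (R S : comNzRingType) (f g : {rmorphism {poly R} -> S}) :
  (forall c, f c%:P = g c%:P) -> f 'X = g 'X -> f =1 g.
Proof.
move=> eqC eqX; elim/poly_ring_ind => // p q Ep Eq.
  by rewrite !rmorphD Ep Eq.
by rewrite !rmorphM Ep Eq.
Qed.

Lemma mpoly_rmorph_eq (R S : comNzRingType) (n : nat)
    (f g : {rmorphism {mpoly R[n]} -> S}) :
  (forall c, f c%:MP = g c%:MP) -> (forall i, f 'X_i = g 'X_i) -> f =1 g.
Proof.
move=> eqC eqX; elim/mpoly_ring_ind => // p q Ep Eq.
  by rewrite !rmorphD Ep Eq.
by rewrite !rmorphM Ep Eq.
Qed.

(** The horner morphism, bundled: it sends 'X to a and is f on constants. *)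
Definition polyev (R S : comNzRingType) (f : {rmorphism R -> S}) (a : S) :
    {rmorphism {poly R} -> S} :=
  horner_morph (fun x => mulrC a (f x)).

Lemma polyevC (R S : comNzRingType) (f : {rmorphism R -> S}) (a : S) (c : R) :
  polyev f a c%:P = f c.
Proof. exact: horner_morphC. Qed.

Lemma polyevX (R S : comNzRingType) (f : {rmorphism R -> S}) (a : S) :
  polyev f a 'X = a.
Proof. exact: horner_morphX. Qed.

Lemma mmap_var (R S : comNzRingType) (n : nat) (f : {rmorphism R -> S})
    (a : 'I_n -> S) (i : 'I_n) :
  mmap f a 'X_i = a i.
Proof. by rewrite mmapX mmap1U. Qed.

(** * Finite extensions and residue fields *)

(** A finite field extension L of k has a k-linear map rho onto k fixing k.
    Such a rho is all that is needed to bring solutions of linear equations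
    from L back to k, and retractions compose along towers. *)
Definition retraction (k L : fieldType) (iota : {rmorphism k -> L})
    (rho : {additive L -> k}) : Prop :=
  (forall a x, rho (iota a * x) = a * rho x) /\ rho 1 = 1.

Lemma retractionK (k L : fieldType) (iota : {rmorphism k -> L})
    (rho : {additive L -> k}) :
  retraction iota rho -> cancel iota rho.
Proof. by case=> lin one a; rewrite -[iota a]mulr1 lin one mulr1. Qed.

Lemma retraction_comp (k L M : fieldType) (iota : {rmorphism k -> L})
    (rho : {additive L -> k}) (iota' : {rmorphism L -> M})
    (rho' : {additive M -> L}) :
  retraction iota rho -> retraction iota' rho' ->
  retraction (iota' \o iota) (rho \o rho').
Proof.
move=> [lin one] [lin' one']; split=> [a x|] /=; first by rewrite lin' lin.
by rewrite one' one.
Qed.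

Lemma fieldExt_retraction (k : fieldType) (L : fieldExtType k) :
  exists rho : {additive L -> k}, retraction (GRing.in_alg L) rho.
Proof.
pose c i (x : L) := coord (vbasis fullv) i x.
have [i nz_i] : exists i, c i 1 != 0.
  apply/existsP; apply: contraT => /existsPn all0.
  have := oner_neq0 L; rewrite (coord_vbasis (memvf (1 : L))) big1 ?eqxx // => i _.
  by have /negPn/eqP ci0 := all0 i; rewrite [coord _ _ _]ci0 scale0r.
pose r (x : L) := c i x / c i 1.
have r_add : zmod_morphism r.
  by move=> x y; rewrite /r /c linearB mulrBl.
pose h := GRing.isZmodMorphism.Build _ _ r r_add.
pose rho : {additive L -> k} := HB.pack r h.
exists rho; split=> [a x|]; last exact: divff.
by rewrite /= mulr_algl /r /c linearZ /= mulrA.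
Qed.

(** The residue field k[z]/(pi): a concrete handle on reduction modulo pi that
    also exposes it as an extension of k with a retraction. *)
Lemma residue_field (k : fieldType) (pi : {poly k}) :
  irreducible_poly pi ->
  exists (L : fieldType) (ev : {rmorphism {poly k} -> L})
         (rho : {additive L -> k}),
    [/\ forall q, ev q = 0 <-> dvdr pi q,
        forall l, exists q, ev q = l
      & retraction (ev \o polyC) rho].
Proof.
move=> irr_pi; have [L _ [z pz0 gen]] := irredp_FAdjoin irr_pi.
have [rho [lin one]] := fieldExt_retraction L.
pose ev := polyev (GRing.in_alg L) z.
have evpi : ev pi = 0 by exact: (rootP pz0).
exists L, ev, rho; split=> [q|l|].
- split=> [evq|[c ->]]; last by rewrite rmorphM evpi mul0r.
  have : pi %| q.
    apply: contraT => ndvd.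
    have cop : coprimep pi q by rewrite irreducible_poly_coprime.
    have /Bezout_eq1_coprimepP[[u v] /= Euv] := cop.
    have := oner_neq0 L; rewrite -(rmorph1 ev) -Euv rmorphD !rmorphM.
    by rewrite evpi evq !mulr0 addr0 eqxx.
  by case/dvdpP => c ->; exists c; rewrite mulrC.
- have : l \in <<1; z>>%VS by rewrite gen memvf.
  by case/Fadjoin1_polyP => p ->; exists p.
- by split=> [a x|]; rewrite //= /ev polyevC lin.
Qed.

Lemma irreducible_factor (k : fieldType) (q : {poly k}) :
  (1 < size q)%N -> exists pi, irreducible_poly pi /\ dvdr pi q.
Proof.
have [n] := ubnP (size q); elim: n q => // n IHn q lt_n gt1.
have [irr|red] := classic (irreducible_poly q).
  by exists q; split=> //; exists 1; rewrite mulr1.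
have q0 : q != 0 by rewrite -size_poly_gt0 ltnW.
have [r [r1 rq neq]] : exists r : {poly k}, [/\ size r != 1, r %| q & ~~ (r %= q)].
  apply: NNPP => none; apply: red; split=> // r r1 rq.
  by apply: contraT => neq; case: none; exists r.
have r0 : r != 0 by apply: contraTneq rq => ->; rewrite dvd0p.
have gt1r : (1 < size r)%N by rewrite ltn_neqAle eq_sym r1 size_poly_gt0.
have ltr : (size r < size q)%N.
  by rewrite ltn_neqAle dvdp_leq // andbT dvdp_size_eqp.
have [|pi [irr [c Er]]] := IHn r _ gt1r; first exact: leq_trans ltr _.
exists pi; split=> //; case/dvdpP: rq => s ->.
by exists (c * s); rewrite Er mulrC mulrA.
Qed.

(** * Irreducible polynomials in two variables are prime *)

Lemma mpoly_dvd_kernel (R S : comNzRingType) (n : nat)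
    (ev : {rmorphism R -> S}) (pi : R) (H : {mpoly R[n]}) :
  (forall q, ev q = 0 -> dvdr pi q) ->
  map_mpoly ev H = 0 -> dvdr pi%:MP H.
Proof.
move=> kerev H0.
have {H0} : forall m, dvdr pi H@_m.
  by move=> m; apply: kerev; rewrite -mcoeff_map_mpoly H0 mcoeff0.
elim/mpolyind: H => [_|c m p mp _ IHp dv]; first by exists 0; rewrite mulr0.
have [u Ec] : dvdr pi c.
  have [u Eu] := dv m; exists u.
  by rewrite -Eu mcoeffD mcoeffZ mcoeffX eqxx mulr1 memN_msupp_eq0 ?addr0.
have [|v ->] := IHp.
  move=> m'; have [e|ne] := eqVneq m m'.
    by exists 0; rewrite -e memN_msupp_eq0 ?mulr0.
  have [u' Eu'] := dv m'; exists u'.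
  by rewrite -Eu' mcoeffD mcoeffZ mcoeffX (negPf ne) mulr0 add0r.
exists (u *: 'X_[m] + v).
by rewrite mulrDr [_ * (u *: _)]mul_mpolyC scalerA -Ec.
Qed.

Lemma poly_dvd_kernel (R S : comNzRingType)
    (ev : {rmorphism R -> S}) (pi : R) (H : {poly R}) :
  (forall q, ev q = 0 -> dvdr pi q) ->
  map_poly ev H = 0 -> dvdr pi%:P H.
Proof.
move=> kerev H0.
have {H0} : forall i, dvdr pi H`_i.
  by move=> i; apply: kerev; rewrite -coef_map H0 coef0.
elim/poly_ind: H => [_|p c IHp dv]; first by exists 0; rewrite mulr0.
have [u Ec] : dvdr pi c.
  by have [u Eu] := dv 0; exists u; rewrite -Eu coefD coefMX coefC add0r.
have [|v ->] := IHp.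
  move=> i; have [u' Eu'] := dv i.+1; exists u'.
  by rewrite -Eu' coefD coefMX coefC addr0.
by exists (v * 'X + u%:P); rewrite mulrDr mulrA -polyCM -Ec.
Qed.

(** An irreducible pi of k[z] generates the kernel of a morphism onto a field
    L, so pi generates the kernel of k[z][v] -> L[v], whose target is a
    domain. *)
Lemma irreducible_polyC_prime (k : fieldType) (pi : {poly k})
    (a b : {poly {poly k}}) :
  irreducible_poly pi -> dvdr pi%:P (a * b) -> dvdr pi%:P a \/ dvdr pi%:P b.
Proof.
move=> irr [c Ec]; have [L [ev [_ [kerev _ _]]]] := residue_field irr.
have ker q : ev q = 0 -> dvdr pi q by move/kerev.
have evpi : ev pi = 0 by apply/kerev; exists 1; rewrite mulr1.
have : map_poly ev a * map_poly ev b == 0.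
  by rewrite -rmorphM Ec rmorphM /= map_polyC /= evpi mul0r.
rewrite mulf_eq0 => /orP[] /eqP.
  by move/(poly_dvd_kernel ker); left.
by move/(poly_dvd_kernel ker); right.
Qed.

(** The prime factors of c, taken one at a time, divide g or r; dividing them
    out turns a factorization of c a into one of a with the same degree in the
    outer variable. *)
Lemma clear_content (k : fieldType) (c : {poly k})
    (a g r : {poly {poly k}}) :
  c != 0 -> c%:P * a = g * r ->
  exists g' r' e, [/\ a = g' * r', size g' = size g, e != 0 & g = e%:P * g'].
Proof.
have [n] := ubnP (size c); elim: n c g r => // n IHn c g r lt_n c0 Ea.
have [le1|gt1] := leqP (size c) 1.
  have [u u0 Ec] : exists2 u, u != 0 & c = u%:P.
    exists c`_0; last exact: size1_polyC.
    by apply: contraNneq c0 => u0; rewrite (size1_polyC le1) u0.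
  exists g, (r * u^-1%:P%:P), 1; split; rewrite ?oner_neq0 ?mul1r //.
  by rewrite mulrA -Ea Ec mulrAC -!polyCM divff // mul1r.
have [pi [irr [c' Ec]]] := irreducible_factor gt1.
have pi0 : pi != 0 by apply: contraTneq (irr.1) => ->; rewrite size_poly0.
have piP0 : pi%:P != 0 :> {poly {poly k}} by rewrite polyC_eq0.
have c'0 : c' != 0 by apply: contraNneq c0 => c'0; rewrite Ec c'0 mulr0.
have ltc' : (size c' < n)%N.
  rewrite Ec size_mul // in lt_n; move: irr.1 lt_n.
  by case: (size pi) => [|[|m]] //= _; rewrite ltnS; apply: leq_trans; rewrite ltnS leq_addl.
have [||[g' Eg]|[r' Er]] := @irreducible_polyC_prime _ pi g r => //.
- by exists (c'%:P * a); rewrite -Ea Ec polyCM mulrA.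
- have E : c'%:P * a = g' * r.
    by apply: (mulfI piP0); rewrite !mulrA -Eg -polyCM -Ec.
  have [h [s [e [Eh sz e0 Eg']]]] := IHn _ _ _ ltc' c'0 E.
  exists h, s, (pi * e); split; rewrite ?mulf_neq0 //.
    by rewrite sz Eg mul_polyC size_scale.
  by rewrite Eg Eg' polyCM mulrA.
- apply: (IHn _ _ r' ltc' c'0); apply: (mulfI piP0).
  by rewrite mulrA -polyCM -Ec Ea Er mulrCA.
Qed.

(** Gauss: this is where unique factorization of k[u,v] is used.  If zeta has
    degree 0 in v, it is an irreducible of k[u].  Otherwise compute a
    pseudo-gcd g of zeta and a over k[u]: when g is constant in v, zeta
    pseudo-divides b, and when it is not, irreducibility makes g a multiple of
    zeta up to content, so zeta pseudo-divides a.  Contents are then cleared. *)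
Lemma irreducible_bipoly_prime (k : fieldType) (zeta : {poly {poly k}}) :
    zeta != 0 ->
    (forall u v, zeta = u * v ->
      u \is a GRing.unit \/ v \is a GRing.unit) ->
  prime_elt zeta.
Proof.
move=> z0 irr a b dv.
have [le1|gt1] := leqP (size zeta) 1.
  have Ez := size1_polyC le1; move: (zeta`_0) Ez => c Ez; rewrite {}Ez {le1} in z0 irr dv *.
  have c0 : c != 0 by rewrite polyC_eq0 in z0.
  have unitP (u : {poly k}) : u%:P \is a @GRing.unit {poly {poly k}} -> size u = 1%N.
    by rewrite poly_unitE coefC /= poly_unitE => /and3P[_ /eqP].
  have [le1|gt1] := leqP (size c) 1.
    left; have Ec := size1_polyC le1; exists ((c`_0)^-1%:P%:P * a).
    rewrite mulrA Ec coefC /= -!polyCM divff ?mul1r //.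
    by apply: contraNneq c0 => h; rewrite Ec h.
  apply: irreducible_polyC_prime => //; split=> // q q1 /dvdpP[r Ec].
  have Ecq : c%:P = r%:P * q%:P by rewrite Ec polyCM.
  have [/unitP r1|/unitP q1'] := irr _ _ Ecq.
    rewrite Ec /eqp dvdp_mull //= -[X in _ %| X]mul1r dvdp_mul2r.
      by rewrite dvdp1 r1.
    by apply: contraNneq c0 => q0; rewrite Ec q0 mulr0.
  by rewrite q1' eqxx in q1.
(* As zeta now has positive degree in v, it has trivial content. *)
have clear c s d : c != 0 -> c%:P * d = zeta * s -> dvdr zeta d.
  move=> c0 /(clear_content c0)[g' [r' [e [-> sz e0 Ez]]]].
  have [/unitrP[u [ue eu]]|] := irr _ _ Ez; last first.
    by rewrite poly_unitE sz => /andP[/eqP sz1]; rewrite sz1 in gt1.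
  by exists (u * r'); rewrite Ez mulrACA eu mul1r.
pose g := gcdp zeta a.
have [cop|] := boolP (coprimep zeta a).
  right; case: dv => s Es.
  have : zeta %| a * b by apply/Pdiv.Idomain.dvdpP; exists (1, s); rewrite ?oner_neq0 // scale1r Es mulrC.
  rewrite Gauss_dvdpr // => /Pdiv.Idomain.dvdpP[[c t] /= c0 Et].
  by apply: (clear c t) => //; rewrite mul_polyC Et mulrC.
rewrite coprimep_def => g1; left.
have g0 : g != 0 by rewrite gcdp_eq0 negb_and z0.
have /Pdiv.Idomain.dvdpP[[c r] /= c0 Er] := dvdp_gcdl zeta a.
have /Pdiv.Idomain.dvdpP[[c2 s] /= c20 Es] := dvdp_gcdr zeta a.
rewrite -/g in g1 Er Es.
have [|g' [r' [e [Ez sz e0 Eg]]]] := clear_content (a := zeta) (g := g) (r := r) c0.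
  by rewrite mul_polyC Er mulrC.
have [|/unitrP[u [ur ru]]] := irr _ _ Ez.
  by rewrite poly_unitE sz (negPf g1).
apply: (clear c2 (u * (e%:P * s))) => //.
rewrite mul_polyC Es Ez Eg !mulrA -(mulrA g') ru mulr1.
by rewrite mulrC [s * _]mulrC mulrA.
Qed.

(** * Polynomials that are algebraically dependent on a prime *)

Lemma dvdrD (R : comNzRingType) (d a b : R) : dvdr d a -> dvdr d b -> dvdr d (a + b).
Proof. by move=> [x ->] [y ->]; exists (x + y); rewrite mulrDr. Qed.

Lemma dvdrMl (R : comNzRingType) (d a b : R) : dvdr d b -> dvdr d (a * b).
Proof. by case=> y ->; exists (a * y); rewrite mulrCA. Qed.

Lemma dvdr_subM (R : comNzRingType) (d a b a' b' : R) :
  dvdr d (a - a') -> dvdr d (b - b') -> dvdr d (a * b - a' * b').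
Proof.
move=> dva dvb.
have -> : a * b - a' * b' = b * (a - a') + a' * (b - b').
  by rewrite !mulrBr [b * a]mulrC [b * a']mulrC addrA subrK.
by apply: dvdrD; apply: dvdrMl.
Qed.

Lemma poly_rmorph_cong (R S : comNzRingType) (d : S)
    (f g : {rmorphism {poly R} -> S}) :
  (forall c, dvdr d (f c%:P - g c%:P)) -> dvdr d (f 'X - g 'X) ->
  forall p, dvdr d (f p - g p).
Proof.
move=> dvC dvX; elim/poly_ring_ind => // p q dvp dvq.
  by rewrite !rmorphD opprD addrACA; apply: dvdrD.
by rewrite !rmorphM; apply: dvdr_subM.
Qed.

Lemma mpoly_rmorph_cong (R S : comNzRingType) (n : nat) (d : S)
    (f g : {rmorphism {mpoly R[n]} -> S}) :
  (forall c, dvdr d (f c%:MP - g c%:MP)) ->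
  (forall i, dvdr d (f 'X_i - g 'X_i)) ->
  forall p, dvdr d (f p - g p).
Proof.
move=> dvC dvX; elim/mpoly_ring_ind => // p q dvp dvq.
  by rewrite !rmorphD opprD addrACA; apply: dvdrD.
by rewrite !rmorphM; apply: dvdr_subM.
Qed.

(** Splitting fields are reached by a tower of residue fields, one root at a
    time. *)
Lemma splitting_extension (k : fieldType) (q : {poly k}) :
  q != 0 ->
  exists (L : fieldType) (iota : {rmorphism k -> L}) (rho : {additive L -> k})
         (c : L) (rs : seq L),
    [/\ retraction iota rho, c != 0
      & map_poly iota q = c *: \prod_(r <- rs) ('X - r%:P)].
Proof.
have [n] := ubnP (size q); elim: n k q => // n IHn k q lt_n q0.
have [le1|gt1] := leqP (size q) 1.
  have Eq := size1_polyC le1.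
  exists k, idfun, idfun, q`_0, [::]; split=> //.
    by apply: contraNneq q0 => q00; rewrite Eq q00.
  by rewrite map_poly_id // big_nil {1}Eq alg_polyC.
have [pi [irr dv]] := irreducible_factor gt1.
have [L [ev [rho [ker _ ret]]]] := residue_field irr.
set iota := ev \o polyC in ret.
have ev_eq : ev =1 polyev iota (ev 'X).
  by apply: poly_rmorph_eq => [c|]; rewrite ?polyevC ?polyevX.
have : root (map_poly iota q) (ev 'X).
  apply/rootP; have -> : (map_poly iota q).[ev 'X] = polyev iota (ev 'X) q by [].
  by rewrite -ev_eq; apply/ker.
case/factor_theorem => q' Eq'.
have Eq0 : map_poly iota q != 0 by rewrite map_poly_eq0.
have q'0 : q' != 0 by apply: contraNneq Eq0 => q'0; rewrite Eq' q'0 mul0r.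
have lt' : (size q' < n)%N.
  rewrite -ltnS; apply: leq_ltn_trans lt_n.
  by rewrite -(size_map_poly iota) Eq' size_mul ?polyXsubC_eq0 // size_XsubC addn2.
have [M [iota' [rho' [c [rs [ret' c0 Es]]]]]] := IHn L q' lt' q'0.
exists M, (iota' \o iota), (rho \o rho'), c, (iota' (ev 'X) :: rs).
split=> //; first exact: retraction_comp ret ret'.
rewrite map_poly_comp Eq' rmorphM /= Es rmorphB /= map_polyX map_polyC /=.
by rewrite big_cons mulrC scalerAr.
Qed.

Lemma map_mpoly_retraction (k L : fieldType) (n : nat)
    (iota : {rmorphism k -> L}) (rho : {additive L -> k})
    (f : {mpoly k[n]}) (g : {mpoly L[n]}) :
  retraction iota rho ->
  map_mpoly rho (map_mpoly iota f * g) = f * map_mpoly rho g.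
Proof.
case=> lin _.
have rhoZX (b : L) (m : 'X_{1.. n}) : map_mpoly rho (b *: 'X_[m]) = rho b *: 'X_[m].
  apply/mpolyP => m'; rewrite mcoeff_map_mpoly /= !mcoeffZ !mcoeffX.
  by case: eqP => _; rewrite ?mulr1 // !mulr0 raddf0.
elim/mpolyind: f => [|a m f _ _ IHf]; first by rewrite rmorph0 !mul0r raddf0.
rewrite rmorphD /= !mulrDl raddfD /= IHf; congr (_ + _) => {f IHf}.
elim/mpolyind: g => [|b m' g _ _ IHg]; first by rewrite mulr0 !raddf0 mulr0.
rewrite mulrDr !raddfD /= mulrDr IHg; congr (_ + _) => {g IHg}.
rewrite map_mpolyZ map_mpolyX rhoZX -!scalerAl -!scalerAr -mpolyXD !scalerA.
by rewrite rhoZX lin mpolyXD.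
Qed.

Definition nonconstant (k : fieldType) (n : nat) (f : {mpoly k[n]}) : Prop :=
  forall c, f <> c%:MP.

Lemma nonconstant_msize (k : fieldType) (n : nat) (f : {mpoly k[n]}) :
  nonconstant f -> (1 < msize f)%N.
Proof.
move=> nc; rewrite ltnNge; apply/negP => le1.
exact: (nc _ (msize1_polyC le1)).
Qed.

Lemma nonconstant_dvd1 (k : fieldType) (n : nat) (f : {mpoly k[n]}) :
  nonconstant f -> ~ dvdr f 1.
Proof.
move=> nc [g Eg]; have gt1 := nonconstant_msize nc.
have fg0 : f * g != 0 by rewrite -Eg oner_neq0.
move: fg0; rewrite mulf_eq0 negb_or => /andP[f0 g0].
have := msizeM f0 g0; rewrite -Eg msize1.
have : (0 < msize g)%N by rewrite lt0n msize_poly_eq0.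
by move: gt1; case: (msize f) => [|[|m]] //; case: (msize g) => [|j] // _ _; rewrite addSn addnS.
Qed.

(** A relation H(s,t) is an element of k[s][t], evaluated at s = f, t = p. *)
Definition rel_ev (k : fieldType) (f p : {mpoly k[2]}) :
    {rmorphism {poly {poly k}} -> {mpoly k[2]}} :=
  polyev (polyev (@mpolyC 2 k) f) p.

(** H(f,p) and H(0,p) agree modulo f. *)
Lemma rel_ev_mod (k : fieldType) (f p : {mpoly k[2]}) (H : {poly {poly k}}) :
  dvdr f (rel_ev f p H - polyev (@mpolyC 2 k) p (map_poly (polyev idfun 0) H)).
Proof.
pose g : {rmorphism _ -> {mpoly k[2]}} := polyev (@mpolyC 2 k) p \o map_poly (polyev (@idfun k) 0).
apply: (poly_rmorph_cong (f := rel_ev f p) (g := g)) => [c|]; last first.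
  by rewrite /g /= map_polyX /rel_ev !polyevX subrr; exists 0; rewrite mulr0.
rewrite /g /= map_polyC /rel_ev /= !polyevC.
pose g' : {rmorphism _ -> {mpoly k[2]}} := @mpolyC 2 k \o polyev (@idfun k) 0.
apply: (poly_rmorph_cong (f := polyev (@mpolyC 2 k) f) (g := g')) => [d|].
  by rewrite /g' /= !polyevC subrr; exists 0; rewrite mulr0.
by rewrite /g' /= !polyevX mpolyC0 subr0; exists 1; rewrite mulr1.
Qed.

(** A relation H(f,p) = 0 may be divided by powers of s, as f is not a zero
    divisor, until H(0,t) is nonzero. *)
Lemma rel_cancel (k : fieldType) (f p : {mpoly k[2]}) (H : {poly {poly k}}) :
  f != 0 -> H != 0 -> rel_ev f p H = 0 ->
  exists H', [/\ rel_ev f p H' = 0 & map_poly (polyev (@idfun k) 0) H' != 0].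
Proof.
move=> f0; have [n] := ubnP (size (lead_coef H)); elim: n H => // n IHn H lt_n H0 EH.
have [E0|N0] := eqVneq (map_poly (polyev (@idfun k) 0) H) 0; last by exists H.
have [|H' EH'] := @poly_dvd_kernel _ _ (polyev (@idfun k) 0) 'X H _ E0.
  move=> q q0; have /factor_theorem[r ->] : root q 0.
    by apply/rootP; rewrite -[RHS]q0 /= /horner_morph map_poly_id.
  by exists r; rewrite subr0 mulrC.
have H'0 : H' != 0 by apply: contraNneq H0 => h; rewrite EH' h mulr0.
apply: (IHn H') => //.
  move: lt_n; rewrite EH' lead_coefM lead_coefC size_mul ?polyX_eq0 ?lead_coef_eq0 //.
  by rewrite size_polyX.
apply: (mulfI f0); rewrite mulr0 -[RHS]EH EH' rmorphM; congr (_ * _).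
by rewrite /rel_ev polyevC polyevX.
Qed.

(** If f and p are algebraically dependent, there is a relation H with
    h(t) = H(0,t) nonzero, so f divides h(p).  Over a splitting field of h this
    is a constant times a product of factors p - r; as f stays prime there, f
    divides some p - r, and the retraction gives p = c + f p1 over k.  The pair
    (f, p1) satisfies H(s, c + s t), and p1 has smaller degree than p.  The
    hypothesis is about all L because each p1 needs its own splitting field. *)
Lemma dependent_polynomial (k : fieldType) (f p : {mpoly k[2]})
    (H : {poly {poly k}}) :
    nonconstant f ->
    (forall (L : fieldType) (iota : {rmorphism k -> L})
        (rho : {additive L -> k}),
      retraction iota rho -> prime_elt (map_mpoly iota f)) ->
    H != 0 -> rel_ev f p H = 0 ->
  exists h, p = polyev (@mpolyC 2 k) f h.
Proof.
move=> nc gprime; have gt1 := nonconstant_msize nc.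
have f0 : f != 0 by apply/eqP => f0; apply: (nc 0); rewrite f0 mpolyC0.
have [n] := ubnP (msize p); elim: n p H => // n IHn p H lt_n H0 EH.
have [le1|gt1p] := leqP (msize p) 1.
  by exists (p@_0)%:P; rewrite polyevC; apply: msize1_polyC.
have [H' [EH' N0]] := rel_cancel f0 H0 EH.
set q := map_poly _ H' in N0.
have [L [iota [rho [c [rs [ret c0 Eq]]]]]] := splitting_extension N0.
pose fL := map_mpoly iota f; pose pL := map_mpoly iota p.
have nunit : ~ dvdr fL 1.
  case=> g Eg; apply: (nonconstant_dvd1 nc); exists (map_mpoly rho g).
  rewrite -(map_mpoly_retraction _ _ ret) -/fL -Eg -mpolyC1 map_mpolyC.
  by rewrite (ret.2).
have dvprod : dvdr fL (\prod_(r <- rs) (pL - r%:MP)).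
  have dvq : dvdr f (polyev (@mpolyC 2 k) p q).
    by have [g Eg] := rel_ev_mod f p H'; exists (- g); rewrite mulrN -Eg EH' sub0r opprK.
  have [g Eg] := dvq.
  have E : map_mpoly iota (polyev (@mpolyC 2 k) p q) = c%:MP * \prod_(r <- rs) (pL - r%:MP).
    transitivity (polyev (@mpolyC 2 L) pL (map_poly iota q)).
      pose g1 : {rmorphism _ -> {mpoly L[2]}} := map_mpoly iota \o polyev (@mpolyC 2 k) p.
      pose g2 : {rmorphism _ -> {mpoly L[2]}} := polyev (@mpolyC 2 L) pL \o map_poly iota.
      apply: (poly_rmorph_eq (f := g1) (g := g2)) => [d|]; rewrite /g1 /g2 /=.
        by rewrite map_polyC /= !polyevC map_mpolyC.
      by rewrite map_polyX !polyevX.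
    rewrite Eq -mul_polyC rmorphM polyevC rmorph_prod; congr (_ * _).
    by apply: eq_bigr => r _; rewrite rmorphB polyevX polyevC.
  exists ((c^-1)%:MP * map_mpoly iota g).
  rewrite mulrCA; have -> : fL * map_mpoly iota g = c%:MP * \prod_(r <- rs) (pL - r%:MP).
    by rewrite -E Eg rmorphM.
  by rewrite mulrA -mpolyCM mulVf // mpolyC1 mul1r.
have [r [g Eg]] : exists r, dvdr fL (pL - r%:MP).
  elim: rs dvprod {Eq} => [|r rs IHrs]; first by rewrite big_nil => /nunit.
  by rewrite big_cons => /(gprime _ _ _ ret)[dv|/IHrs //]; exists r.
pose p1 := map_mpoly rho g.
have Ep : p = (rho r)%:MP + f * p1.
  rewrite -(map_mpoly_retraction _ _ ret) -/fL -Eg raddfB /= map_mpolyC addrC subrK.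
  rewrite /pL; apply/mpolyP => m; rewrite !mcoeff_map_mpoly /=.
  by rewrite (retractionK ret).
have [p10|p10] := eqVneq p1 0.
  by exists (rho r)%:P; rewrite polyevC [LHS]Ep p10 mulr0 addr0.
have ltp1 : (msize p1 < n)%N.
  have le : (msize (f * p1) <= msize p)%N.
    have -> : f * p1 = p - (rho r)%:MP by rewrite {1}Ep addrC addKr.
    apply: leq_trans (msizeD_le _ _) _; rewrite geq_max leqnn msizeN /= msizeC.
    by case: (_ != _) => //=; apply: ltnW.
  rewrite msizeM // in le; apply: leq_trans (lt_n : (msize p <= n)%N).
  apply: leq_trans le; move: gt1; case: (msize f) => [|[|m]] // _.
  by rewrite !addSn ltnS leq_addl.
pose s : {poly {poly k}} := (rho r)%:P%:P + 'X%:P * 'X.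
have ss : size s = 2.
  by rewrite /s addrC size_MXaddC polyC_eq0 polyX_eq0 /= size_polyC polyX_eq0.
have [||h Eh] := IHn p1 (H' \Po s) ltp1.
- by rewrite comp_poly2_eq0 //; apply: contraNneq N0 => h; rewrite /q h rmorph0.
- rewrite -[RHS]EH'.
  pose g1 : {rmorphism _ -> {mpoly k[2]}} := rel_ev f p1 \o comp_poly s.
  apply: (poly_rmorph_eq (f := g1) (g := rel_ev f p)) => [d|]; rewrite /g1 /=.
    by rewrite comp_polyC /rel_ev !polyevC.
  by rewrite comp_polyX /s rmorphD rmorphM /rel_ev !(polyevC, polyevX) -Ep.
by exists ((rho r)%:P + 'X * h); rewrite rmorphD rmorphM polyevC polyevX -Eh.
Qed.

(** * Fibres of a coordinate over points of the z-line *)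

Lemma ord2_ind (P : 'I_2 -> Prop) : P ord0 -> P (lift ord0 ord0) -> forall i, P i.
Proof.
move=> P0 P1 [[|[|i]] lt_i] //.
  by rewrite (_ : Ordinal _ = ord0) //; apply: val_inj.
by rewrite (_ : Ordinal _ = lift ord0 ord0) //; apply: val_inj.
Qed.

(** If sigma reaches the variables up to the denominator d, it reaches every
    element up to a power of d, because the elements with this property form a
    subring. *)
Lemma denominators (R T : comNzRingType) (n : nat)
    (sigma : {rmorphism T -> {mpoly R[n]}}) (d : R) :
    (forall c, exists X, c%:MP = sigma X) ->
    (forall i, exists X, d%:MP * 'X_i = sigma X) ->
  forall r, exists N X, d%:MP ^+ N * r = sigma X.
Proof.
move=> imC imX; elim/mpoly_ring_ind => [c|i|r s [N [X EX]] [N' [X' EX']]|r s [N [X EX]] [N' [X' EX']]].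
- by have [X EX] := imC c; exists 0, X; rewrite expr0 mul1r.
- by have [X EX] := imX i; exists 1, X; rewrite expr1.
- have [D ED] := imC d; exists (N + N')%N, (D ^+ N' * X + D ^+ N * X').
  rewrite rmorphD !rmorphM !rmorphXn /= -ED -EX -EX' mulrDr exprD.
  by rewrite -!mulrA; congr (_ + _); rewrite mulrCA.
- by exists (N + N')%N, (X * X'); rewrite rmorphM /= -EX -EX' exprD mulrACA.
Qed.

(** The pair (f, p) is a coordinate system after inverting d; this is the
    statement that the induction on the degree of d carries. *)
Definition nearly_coordinates (R : comNzRingType) (f p : {mpoly R[2]})
    (d : R) : Prop :=
  [/\ d != 0, injective (comp_mpoly [tuple f; p])
    & forall i, exists X, d%:MP * 'X_i = X \mPo [tuple f; p]].

(** The quotient by f is a polynomial ring in two variables over k: phi is the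
    quotient map. *)
Definition plane_fibre (k : fieldType) (f : {mpoly {poly k}[2]}) : Prop :=
  exists phi : {rmorphism {mpoly {poly k}[2]} -> {poly {poly k}}},
    [/\ forall c, phi c%:P%:MP = c%:P%:P,
        forall b, exists a, phi a = b,
        phi f = 0
      & forall r, phi r = 0 -> dvdr f r].

(** Restriction to the plane z = alpha. *)
Definition at_z (k : fieldType) (n : nat) (alpha : k) :
    {rmorphism {mpoly {poly k}[n]} -> {mpoly k[n]}} :=
  map_mpoly (polyev (@idfun k) alpha).

Lemma bipoly_unit (k : fieldType) (b : {poly {poly k}}) :
  b \is a GRing.unit -> exists2 m, m != 0 & b = m%:P%:P.
Proof.
rewrite poly_unitE => /andP[/eqP s1]; rewrite poly_unitE => /andP[/eqP s2 u].
exists b`_0`_0; first by rewrite -unitfE.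
by rewrite -size1_polyC ?s2 // -size1_polyC ?s1.
Qed.

Section FibrePrime.

Variables (k : fieldType) (f p : {mpoly {poly k}[2]}) (d : {poly k}).
Variable phi : {rmorphism {mpoly {poly k}[2]} -> {poly {poly k}}}.
Hypothesis phiC : forall c, phi c%:P%:MP = c%:P%:P.
Hypothesis phi_surj : forall b, exists a, phi a = b.
Hypothesis phif : phi f = 0.
Hypothesis phi_ker : forall r, phi r = 0 -> dvdr f r.
Hypothesis inj : injective (comp_mpoly [tuple f; p]).
Hypothesis d0 : d != 0.
Hypothesis im : forall i, exists X, d%:MP * 'X_i = X \mPo [tuple f; p].

Let A := {mpoly {poly k}[2]}.
Let B := {poly {poly k}}.
(* Write B for the quotient by f, and c(u) for the image in it of u in k[z]. *)
Let c : {rmorphism {poly k} -> B} := phi \o @mpolyC 2 {poly k}.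
Let J : {rmorphism B -> A} := polyev (@mpolyC 2 {poly k}) 'X_(lift ord0 ord0).
Let V : {rmorphism A -> B} := mmap (@polyC {poly k}) (tnth [tuple 0; 'X]).
(* J and V identify k[z][t] with the polynomials in z and the second variable;
   E maps k[z][t] to B by sending t to the class of p. *)
Let E : {rmorphism B -> B} := phi \o (comp_mpoly [tuple f; p] \o J).

Let subst0 : 'X_ord0 \mPo [tuple f; p] = f.
Proof. by rewrite comp_mpolyXU. Qed.

Let VJ Q : V (J Q) = Q.
Proof.
apply: (poly_rmorph_eq (f := V \o J : {rmorphism _ -> _}) (g := idfun)) => [u|] /=.
  by rewrite /J polyevC /V /= mmapC.
by rewrite /J polyevX /V /= mmap_var.
Qed.

Let V0 : V 'X_ord0 = 0. Proof. by rewrite /V /= mmap_var. Qed.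

Let JV a : dvdr 'X_ord0 (a - J (V a)).
Proof.
apply: (mpoly_rmorph_cong (f := idfun) (g := J \o V : {rmorphism _ -> _})) => [u|] /=.
  by rewrite /V /= mmapC /J polyevC subrr; exists 0; rewrite mulr0.
apply: ord2_ind; rewrite /V /= mmap_var /=.
  by rewrite rmorph0 subr0; exists 1; rewrite mulr1.
by rewrite (tnth_nth 0) /= /J polyevX subrr; exists 0; rewrite mulr0.
Qed.

Let f0 : f != 0.
Proof.
apply/eqP => f_0; have : 'X_ord0 = 0 :> A by apply: inj; rewrite subst0 rmorph0.
by move/(congr1 (mcoeff U_(ord0))); rewrite mcoeffX eqxx mcoeff0 => /eqP; rewrite oner_eq0.
Qed.

Let EC u : E u%:P = c u.
Proof. by rewrite /E /= /J polyevC comp_mpolyC. Qed.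

(* k[z][t] is a subring of B: a relation between z and p modulo f would
   become, up to a power of d, a relation between f and p that is a multiple
   of f, and f, p are algebraically independent over k[z]. *)
Let E_inj : injective E.
Proof.
suff E0 Q : E Q = 0 -> Q = 0.
  move=> Q Q' EQ; apply/eqP; rewrite -subr_eq0; apply/eqP/E0.
  by rewrite rmorphB EQ subrr.
move=> /phi_ker[r Er].
have [N [X EX]] := denominators (sigma := comp_mpoly [tuple f; p])
  (fun u => ex_intro _ u%:MP (esym (comp_mpolyC _ _))) im r.
have : d%:MP ^+ N * J Q - 'X_ord0 * X = 0.
  apply: inj; rewrite rmorph0 rmorphB !rmorphM rmorphXn /=.
  rewrite comp_mpolyC subst0 [J Q \mPo _]Er -EX; apply/eqP; rewrite subr_eq0; apply/eqP.
  by rewrite mulrCA.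
move/(congr1 V); rewrite rmorph0 rmorphB !rmorphM rmorphXn VJ V0 mul0r subr0.
have -> : V d%:MP = d%:P by rewrite /V /= mmapC.
by move/eqP; rewrite mulf_eq0 expf_eq0 polyC_eq0 (negPf d0) andbF => /eqP.
Qed.

Let c_inj : injective c.
Proof. by move=> u v; rewrite -!EC => /E_inj /polyC_inj. Qed.

Let c_const (m : k) : c m%:P = m%:P%:P. Proof. exact: phiC. Qed.

(* After inverting d the two rings coincide. *)
Let E_lift b : exists N Q, c d ^+ N * b = E Q.
Proof.
have [a <-] := phi_surj b.
have [N [X EX]] := denominators (sigma := comp_mpoly [tuple f; p])
  (fun u => ex_intro _ u%:MP (esym (comp_mpolyC _ _))) im a.
exists N, (V X); rewrite /c /= -rmorphXn -rmorphM EX /E /=.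
have [Y EY] := JV X; apply/eqP; rewrite -subr_eq0 -rmorphB -rmorphB EY rmorphM.
by rewrite /= subst0 rmorphM phif mul0r.
Qed.

(* k(z) meets B in k[z]: if Q/v is in lowest terms and lies in B, Bezout
   makes v a unit of B, and the units of B are the constants of k. *)
Let c_closed v q Q : v != 0 -> c v * q = c Q -> exists Q1, q = c Q1.
Proof.
move=> v0 Eq; set g := gcdp v Q.
have g0 : g != 0 by rewrite gcdp_eq0 negb_and v0.
have [v1 Ev] : exists v1, v = v1 * g by exact/dvdpP/dvdp_gcdl.
have [Q1 EQ] : exists Q1, Q = Q1 * g by exact/dvdpP/dvdp_gcdr.
have cg0 : c g != 0 by rewrite -(rmorph0 c) (inj_eq c_inj).
have Eq1 : c v1 * q = c Q1.
  by apply: (mulIf cg0); rewrite -[RHS]rmorphM -EQ -Eq Ev rmorphM mulrAC.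
have /Bezout_eq1_coprimepP[[s t] /= Est] : coprimep v1 Q1.
  have -> : v1 = v %/ g by rewrite Ev mulpK.
  have -> : Q1 = Q %/ g by rewrite EQ mulpK.
  by apply: coprimep_div_gcd; rewrite v0.
have uv1 : c v1 \is a GRing.unit.
  apply/unitrP; exists (c s + c t * q); have E1 : (c s + c t * q) * c v1 = 1.
    by rewrite mulrDl -mulrA [q * _]mulrC Eq1 -!rmorphM -rmorphD Est rmorph1.
  by split=> //; rewrite mulrC.
have [m m0 Em] := bipoly_unit uv1.
exists (m^-1%:P * Q1); rewrite [RHS](rmorphM c) -Eq1 Em !c_const mulrA -!polyCM mulVf //.
by rewrite mul1r.
Qed.

Variable alpha : k.
Let zeta := c ('X - alpha%:P).

Let zeta0 : zeta != 0.
Proof. by rewrite -(rmorph0 c) (inj_eq c_inj) polyXsubC_eq0. Qed.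

(* In a factorization of z - alpha in B, both factors times powers of d lie in
   k[z][t]; their product has degree 0 in t, so they lie in k(z), hence in
   k[z], where z - alpha is irreducible. *)
Let zeta_irr u v : zeta = u * v -> u \is a GRing.unit \/ v \is a GRing.unit.
Proof.
move=> Ez; have [N [Q EQ]] := E_lift u; have [N' [Q' EQ']] := E_lift v.
have EQQ : Q * Q' = (d ^+ (N + N') * ('X - alpha%:P))%:P.
  apply: E_inj; rewrite EC rmorphM -EQ -EQ' mulrACA -exprD -Ez.
  by rewrite rmorphM rmorphXn.
have [Q0 Q'0] : Q != 0 /\ Q' != 0.
  apply/andP; rewrite -negb_or -mulf_eq0 EQQ polyC_eq0 mulf_neq0 ?polyXsubC_eq0 //.
  by rewrite expf_neq0.
have := congr1 (fun q : B => size q) EQQ; rewrite size_mul // size_polyC mulf_neq0 ?polyXsubC_eq0 ?expf_neq0 //.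
have cst (w : B) (Qw : B) M : Qw != 0 -> c d ^+ M * w = E Qw -> size Qw = 1%N -> exists w1, w = c w1.
  move=> Qw0 EQw sQ; apply: (@c_closed (d ^+ M) w Qw`_0); first by rewrite expf_neq0.
  by rewrite (rmorphXn c) EQw -EC -[in RHS]size1_polyC ?sQ.
move: (Q0) (Q'0); rewrite -!size_poly_gt0 => gQ gQ' sQQ.
have [sQ sQ'] : size Q = 1%N /\ size Q' = 1%N.
  move: gQ gQ' sQQ; case: (size Q) (size Q') => [|[|m]] [|[|m']] //= _ _;
    by rewrite ?addSn ?addnS.
have [u1 Eu] := cst _ _ _ Q0 EQ sQ; have [v1 Ev] := cst _ _ _ Q'0 EQ' sQ'.
have Euv : u1 * v1 = 'X - alpha%:P by apply: c_inj; rewrite rmorphM -Eu -Ev -Ez.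
have nz : u1 * v1 != 0 by rewrite Euv polyXsubC_eq0.
have [u10 v10] : u1 != 0 /\ v1 != 0 by apply/andP; rewrite -negb_or -mulf_eq0.
have cunit (w : {poly k}) : w != 0 -> size w = 1%N -> c w \is a GRing.unit.
  move=> w0 sw; have Ew : w = (w`_0)%:P by rewrite -size1_polyC ?sw.
  apply: rmorph_unit; rewrite poly_unitE sw /= unitfE.
  by apply: contraNneq w0 => w00; rewrite Ew w00.
have := congr1 (fun q : {poly k} => size q) Euv; rewrite size_mul // size_XsubC.
have : (0 < size u1)%N by rewrite size_poly_gt0.
have : (0 < size v1)%N by rewrite size_poly_gt0.
case Es: (size u1) => [|[|m]] //; case Es': (size v1) => [|[|m']] // _ _; rewrite ?addSn ?addnS //= => _.
- by left; rewrite Eu; apply: cunit.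
- by right; rewrite Ev; apply: cunit.
Qed.

Let zeta_prime : prime_elt zeta.
Proof. exact: irreducible_bipoly_prime zeta0 zeta_irr. Qed.

Let zeta_nunit : zeta \isn't a GRing.unit.
Proof.
apply/negP => /bipoly_unit[m m0]; rewrite -c_const => /c_inj Em.
by have := congr1 (fun q : {poly k} => size q) Em; rewrite size_XsubC size_polyC m0.
Qed.

Let const_in : {rmorphism {mpoly k[2]} -> A} := map_mpoly (@polyC k).

Let at_zK a : at_z _ alpha (const_in a) = a.
Proof. by apply/mpolyP => m; rewrite !mcoeff_map_mpoly /= polyevC. Qed.

Let at_z_ker (a : A) : at_z _ alpha a = 0 -> dvdr ('X - alpha%:P)%:MP a.
Proof.
apply: mpoly_dvd_kernel => q q0; have /factor_theorem[r ->] : root q alpha.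
  by apply/rootP; rewrite -[RHS]q0 /= /horner_morph map_poly_id.
by exists r; rewrite mulrC.
Qed.

Let at_z_lin : at_z 2 alpha ('X - alpha%:P)%:MP = 0.
Proof. by rewrite /at_z /= map_mpolyC /= rmorphB /= polyevX polyevC subrr mpolyC0. Qed.

(** B/(z - alpha) is also the quotient of k[x,y] by f(x,y,alpha); being a
    nonzero domain, it makes f(x,y,alpha) prime and nonconstant. *)
Lemma fibre_prime_aux : prime_elt (at_z _ alpha f) /\ nonconstant (at_z _ alpha f).
Proof.
split=> [a b [r Er]|m Em].
  have [e Ee] : dvdr ('X - alpha%:P)%:MP (const_in a * const_in b - f * const_in r).
    apply: at_z_ker.
    have ab : at_z 2 alpha (const_in a * const_in b) = a * b.
      by rewrite (rmorphM (at_z 2 alpha)); congr (_ * _); exact: at_zK.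
    have fr : at_z 2 alpha (f * const_in r) = at_z 2 alpha f * r.
      by rewrite (rmorphM (at_z 2 alpha)); congr (_ * _); exact: at_zK.
    by rewrite (rmorphB (at_z 2 alpha)) ab fr Er subrr.
  have : dvdr zeta (phi (const_in a) * phi (const_in b)).
    have phifr : phi (f * const_in r) = 0 by rewrite (rmorphM phi) phif mul0r.
    exists (phi e); rewrite -(rmorphM phi) -[LHS]subr0 -phifr -(rmorphB phi).
    by rewrite Ee (rmorphM phi).
  have pull (a' : {mpoly k[2]}) : dvdr zeta (phi (const_in a')) -> dvdr (at_z _ alpha f) a'.
    case=> b'; have [a1 <-] := phi_surj b' => Ea'.
    have [|r1 Er1] := phi_ker (r := const_in a' - ('X - alpha%:P)%:MP * a1).
      by rewrite rmorphB rmorphM Ea' subrr.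
    exists (at_z _ alpha r1); rewrite -rmorphM -Er1 rmorphB rmorphM at_zK at_z_lin.
    by rewrite mul0r subr0.
  by case/zeta_prime => dv; [left|right]; apply: pull.
have [e Ee] : dvdr ('X - alpha%:P)%:MP (f - m%:P%:MP).
  by apply: at_z_ker; rewrite rmorphB Em /at_z /= map_mpolyC /= polyevC subrr.
have Ephi : - m%:P%:P = zeta * phi e.
  by rewrite /zeta /c /= -rmorphM -Ee rmorphB phif phiC sub0r.
have [m0|m0] := eqVneq m 0; last first.
  case/negP: zeta_nunit; apply/unitrP; exists (phi e * (- (m^-1))%:P%:P).
  have Ez : zeta * (phi e * (- m^-1)%:P%:P) = 1.
    by rewrite mulrA -Ephi mulNr -!polyCM mulrN divff // !polyCN opprK.
  by split=> //; rewrite mulrC.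
have : zeta * phi e == 0 by rewrite -Ephi m0 oppr0.
rewrite mulf_eq0 (negPf zeta0) => /eqP /phi_ker[e' Ee'].
have Ef : f * 1 = f * (('X - alpha%:P)%:MP * e').
  by rewrite mulrCA -Ee' -Ee m0 mpolyC0 subr0 mulr1.
have := congr1 (at_z _ alpha) (mulfI f0 Ef).
by rewrite rmorph1 rmorphM at_z_lin mul0r => /eqP; rewrite oner_eq0.
Qed.

End FibrePrime.

Lemma fibre_prime (k : fieldType) (f p : {mpoly {poly k}[2]}) (d : {poly k}) (alpha : k) :
    plane_fibre f -> nearly_coordinates f p d ->
  prime_elt (at_z _ alpha f) /\ nonconstant (at_z _ alpha f).
Proof.
case=> phi [phiC surj phif ker] [d0 inj im].
exact: (fibre_prime_aux (phi := phi) (p := p) (d := d)).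
Qed.

(** * Base change *)

Lemma map_comp_mpoly2 (R S : comNzRingType) (j : {rmorphism R -> S})
    (f p H : {mpoly R[2]}) :
  map_mpoly j (H \mPo [tuple f; p]) =
  map_mpoly j H \mPo [tuple map_mpoly j f; map_mpoly j p].
Proof.
pose g1 : {rmorphism {mpoly R[2]} -> {mpoly S[2]}} :=
  map_mpoly j \o comp_mpoly [tuple f; p].
pose g2 : {rmorphism {mpoly R[2]} -> {mpoly S[2]}} :=
  comp_mpoly [tuple map_mpoly j f; map_mpoly j p] \o map_mpoly j.
apply: (mpoly_rmorph_eq (f := g1) (g := g2)) => [c|]; rewrite /g1 /g2 /=.
  by rewrite map_mpolyC !comp_mpolyC map_mpolyC.
by apply: ord2_ind; rewrite map_mpolyX !comp_mpolyXU.
Qed.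

Section Retract.

Variables (R S : comNzRingType) (j : {rmorphism R -> S}) (r : {additive S -> R}).
Hypothesis r_lin : forall c a, r (c * j a) = r c * a.

Lemma map_mpoly_lin (n : nat) (c : S) (g : {mpoly R[n]}) :
  map_mpoly r (c *: map_mpoly j g) = r c *: g.
Proof. by apply/mpolyP => m; rewrite mcoeff_map_mpoly !mcoeffZ mcoeff_map_mpoly /= r_lin. Qed.

(** As r is R-linear, applying it to coefficients commutes with substituting
    polynomials that have coefficients in R. *)
Lemma map_comp_mpoly2_lin (f p : {mpoly R[2]}) (H : {mpoly S[2]}) :
  map_mpoly r (H \mPo [tuple map_mpoly j f; map_mpoly j p]) =
  map_mpoly r H \mPo [tuple f; p].
Proof.
elim/mpolyind: H => [|c m H _ _ IH]; first by rewrite !raddf0.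
rewrite !raddfD /= IH; congr (_ + _).
rewrite !comp_mpolyZ -(map_mpolyX j) -map_comp_mpoly2.
by rewrite !map_mpoly_lin comp_mpolyZ.
Qed.

End Retract.

(** A nonzero relation over L has a coefficient x <> 0; multiplying by x^-1 and
    applying rho to coefficients gives a relation over k in which that
    coefficient is 1. *)
Lemma base_change_inj (k L : fieldType) (iota : {rmorphism k -> L})
    (rho : {additive L -> k}) (f p : {mpoly {poly k}[2]}) :
    retraction iota rho -> injective (comp_mpoly [tuple f; p]) ->
  injective (comp_mpoly [tuple map_mpoly (map_poly iota) f;
                               map_mpoly (map_poly iota) p]).
Proof.
move=> [lin one] inj H H' EH; apply/eqP; rewrite -subr_eq0; apply/eqP.
have: (H - H') \mPo [tuple map_mpoly (map_poly iota) f; map_mpoly (map_poly iota) p] = 0.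
  by rewrite rmorphB /= EH subrr.
move: (H - H') => {EH H'}H EH.
apply/mpolyP => m; rewrite mcoeff0; apply/polyP => i; rewrite coef0.
apply/eqP; apply: contraT => x0; set x := _`_i in x0.
have scale_add : zmod_morphism (fun y => rho (x^-1 * y)).
  by move=> y z; rewrite mulrBr raddfB.
pose h := GRing.isZmodMorphism.Build _ _ _ scale_add.
pose rx : {additive L -> k} := HB.pack (fun y => rho (x^-1 * y)) h.
have rx_lin (c : {poly L}) (a : {poly k}) :
    map_poly rx (c * map_poly iota a) = map_poly rx c * a.
  apply/polyP => l; rewrite coef_map /= coefM mulr_sumr raddf_sum coefM.
  apply: eq_bigr => s _; rewrite (coef_map rx) coef_map /=.
  by rewrite mulrA [_ * iota _]mulrC lin mulrC.
have := map_comp_mpoly2_lin rx_lin f p H; rewrite EH raddf0.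
rewrite -(rmorph0 (comp_mpoly [tuple f; p])) => /inj /(congr1 (mcoeff m)).
rewrite mcoeff_map_mpoly mcoeff0 => /(congr1 (fun q : {poly k} => q`_i)).
rewrite coef_map coef0 /= mulVf // one => /eqP.
by rewrite eq_sym oner_eq0.
Qed.

Lemma ord3_ind (P : 'I_3 -> Prop) :
  P ord0 -> P (lift ord0 ord0) -> P ord_max -> forall i, P i.
Proof.
move=> P0 P1 P2 [[|[|[|i]]] lt_i] //.
- by rewrite (_ : Ordinal _ = ord0) //; apply: val_inj.
- by rewrite (_ : Ordinal _ = lift ord0 ord0) //; apply: val_inj.
- by rewrite (_ : Ordinal _ = ord_max) //; apply: val_inj.
Qed.

Lemma poly_hom (R S : comNzRingType) (h : {rmorphism R -> S}) (a : S) :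
  exists phi : {rmorphism {poly R} -> S}, (forall c, phi c%:P = h c) /\ phi 'X = a.
Proof. by exists (polyev h a); split=> [c|]; rewrite ?polyevC ?polyevX. Qed.

Lemma mpoly_hom (R S : comNzRingType) (n : nat) (h : {rmorphism R -> S})
    (a : 'I_n -> S) :
  exists phi : {rmorphism {mpoly R[n]} -> S},
    (forall c, phi c%:MP = h c) /\ (forall i, phi 'X_i = a i).
Proof. by exists (mmap h a); split=> x; rewrite /= ?mmapC ?mmap_var. Qed.

(** In the coordinates that complete f, k[x,y,z] is a polynomial ring and f is
    its first variable; phi expresses x, y, z in them and sets that variable to
    0.  The morphism psi, which maps the two other variables back, inverts phi
    modulo f, which identifies the kernel. *)
Lemma coordinate_plane_fibre (k L : fieldType) (iota : {rmorphism k -> L})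
    (f : {mpoly k[3]}) :
  coordinate f -> plane_fibre (map_mpoly (map_poly iota) (poly_xyz_z_xy f)).
Proof.
pose A := {mpoly {poly L}[2]}; pose B := {poly {poly L}}.
pose i1 : 'I_3 := lift ord0 ord0.
pose j1 : 'I_2 := lift ord0 ord0.
have [T [TC T0 T1 T2 Tf]] : exists T : {rmorphism {mpoly k[3]} -> A},
    [/\ forall c, T c%:MP = (iota c)%:P%:MP, T 'X_ord0 = 'X_ord0,
        T 'X_i1 = 'X_j1, T 'X_ord_max = 'X%:MP
      & T f = map_mpoly (map_poly iota) (poly_xyz_z_xy f)].
  exists (map_mpoly (map_poly iota) \o
    mmap (@mpolyC 2 {poly k} \o polyC)
         (tnth [tuple 'X_0; 'X_1; ('X : {poly k})%:MP])).
  split=> [c||||//] /=; first by rewrite mmapC /= map_mpolyC /= map_polyC.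
  - by rewrite mmap_var map_mpolyX.
  - by rewrite mmap_var (tnth_nth 0) map_mpolyX; congr 'X_[ U_(_) ]; apply: val_inj.
  - by rewrite mmap_var (tnth_nth 0) map_mpolyC /= map_polyX.
rewrite -{}Tf => -[g [inv invK Kinv]].
set G := [tuple of f :: g] in invK Kinv.
have [w [wC wX]] := mpoly_hom (polyC \o polyC \o iota) (tnth [tuple 0; 'X%:P; 'X : B]).
pose G' i := inv 'X_i.
have KG i : G' i \mPo G = 'X_i by rewrite /G' Kinv.
have [back [backC backX]] := mpoly_hom (@mpolyC 3 k) G'.
have backG i : back (tnth G i) = 'X_i.
  have GG q : back q \mPo G = q.
    pose g1 : {rmorphism {mpoly k[3]} -> {mpoly k[3]}} := comp_mpoly G \o back.
    apply: (mpoly_rmorph_eq (f := g1) (g := idfun)) => [c|j]; rewrite /g1 /=.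
      by rewrite backC comp_mpolyC.
    by rewrite backX KG.
  by rewrite -[LHS]invK -[RHS]invK GG comp_mpolyXU -tnth_nth.
have [pz [pzC pzX]] := poly_hom (polyC \o polyC : {rmorphism L -> B}) (w (G' ord_max)).
have [phi [phiP phiX]] := mpoly_hom pz (tnth [tuple w (G' ord0); w (G' i1)]).
have phiX0 : phi 'X_ord0 = w (G' ord0) by rewrite phiX.
have phiX1 : phi 'X_j1 = w (G' i1) by rewrite phiX (tnth_nth 0).
have phiC c : phi c%:P%:MP = c%:P%:P by rewrite phiP pzC.
have phiT q : phi (T q) = w (back q).
  apply: (mpoly_rmorph_eq (f := phi \o T : {rmorphism _ -> _})
                          (g := w \o back : {rmorphism _ -> _})) => [c|] /=.
    by rewrite TC phiC backC wC.
  by apply: ord3_ind; rewrite backX ?T0 ?T1 ?T2 ?phiX0 ?phiX1 ?phiP ?pzX.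
have phiTG i : phi (T (tnth G i)) = tnth [tuple 0; 'X%:P; 'X] i.
  by rewrite phiT backG wX.
have [psi1 [psi1C psi1X]] := poly_hom (@mpolyC 2 {poly L} \o polyC) (T (tnth G i1)).
have [psi [psiP psiX]] := poly_hom psi1 (T (tnth G ord_max)).
have psiK b : phi (psi b) = b.
  apply: (poly_rmorph_eq (f := phi \o psi : {rmorphism _ -> _}) (g := idfun)) => [c|] /=; last first.
    by rewrite psiX phiTG.
  rewrite psiP; apply: (poly_rmorph_eq (f := phi \o psi1 : {rmorphism _ -> _}) (g := polyC)) => [d|] /=.
    by rewrite psi1C /= phiC.
  by rewrite psi1X phiTG.
have Tf : T (tnth G ord0) = T f by [].
have dv0 (F : A) : dvdr F 0 by exists 0; rewrite mulr0.
(* A polynomial in the new coordinates is determined modulo f by w, which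
   forgets the first of them. *)
have congG q : dvdr (T f) (T (q \mPo G) - psi (w q)).
  apply: (mpoly_rmorph_cong (f := T \o comp_mpoly G : {rmorphism _ -> _})
                            (g := psi \o w : {rmorphism _ -> _})) => [c|i] /=.
    by rewrite comp_mpolyC TC wC psiP psi1C subrr.
  rewrite comp_mpolyXU -tnth_nth wX; elim/ord3_ind: i.
  - by rewrite Tf rmorph0 subr0; exists 1; rewrite mulr1.
  - by rewrite [tnth [tuple 0; _; _] _](tnth_nth 0) /= psiP psi1X subrr.
  - by rewrite [tnth [tuple 0; _; _] _](tnth_nth 0) /= psiX subrr.
have closeX i b : T 'X_i = b -> phi b = w (G' i) -> dvdr (T f) (b - psi (phi b)).
  by move=> Eb ->; rewrite -Eb -{1}(KG i).
have congT a : dvdr (T f) (a - psi (phi a)).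
  apply: (mpoly_rmorph_cong (f := idfun) (g := psi \o phi : {rmorphism _ -> _})) => [c|] /=.
    rewrite phiP; apply: (poly_rmorph_cong (f := @mpolyC 2 {poly L} : {rmorphism {poly L} -> A})
              (g := psi \o pz : {rmorphism {poly L} -> A}) _ _ c) => [d|] /=.
      by rewrite pzC psiP psi1C subrr.
    by rewrite -phiP; apply: closeX T2 _; rewrite phiP pzX.
  by apply: ord2_ind; [apply: closeX T0 _|apply: closeX T1 _].
exists phi; split=> // [b||r phir].
- by exists (psi b).
- by rewrite -Tf phiTG.
- by have := congT r; rewrite phir rmorph0 subr0.
Qed.

(** * Removing the denominator *)

(** If u(f) = 0, then f divides the constant term of u; being no unit, f forces
    that term to vanish, and a factor f can be cancelled. *)
Lemma polyev_nonconstant (k : fieldType) (n : nat) (f : {mpoly k[n]}) (u : {poly k}) :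
  nonconstant f -> polyev (@mpolyC n k) f u = 0 -> u = 0.
Proof.
move=> nc; elim/poly_ind: u => // u c IHu.
rewrite rmorphD rmorphM polyevC polyevX => /eqP; rewrite addr_eq0 => /eqP Eu.
have [c0|c0] := eqVneq c 0; last first.
  case: (nonconstant_dvd1 nc); exists (polyev (@mpolyC n k) f u * (- c^-1)%:MP).
  rewrite mulrA [f * _]mulrC Eu mpolyCN mulrNN -mpolyCM divff //.
have : polyev (@mpolyC n k) f u * f == 0 by rewrite Eu oppr_eq0 mpolyC_eq0 c0.
rewrite mulf_eq0 => /orP[/eqP /IHu ->|/eqP f0]; first by rewrite c0 mul0r addr0.
by case: (nc 0); rewrite f0 mpolyC0.
Qed.

Lemma surjective_map_poly (R S : comNzRingType) (ev : {rmorphism R -> S}) :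
  (forall l, exists q, ev q = l) -> forall h, exists q, map_poly ev q = h.
Proof.
move=> surj; elim/poly_ring_ind => [c||h h' [q <-] [q' <-]|h h' [q <-] [q' <-]].
- by have [q <-] := surj c; exists q%:P; rewrite map_polyC.
- by exists 'X; rewrite map_polyX.
- by exists (q + q'); rewrite rmorphD.
- by exists (q * q'); rewrite rmorphM.
Qed.

(** All hypotheses of [fibre_prime] pass from k to a finite extension L, where
    the planes z = alpha with alpha algebraic over k live. *)
Lemma fibre_over (k : fieldType) (f0 : {mpoly k[3]}) (p : {mpoly {poly k}[2]})
    (d : {poly k}) (L : fieldType) (iota : {rmorphism k -> L})
    (rho : {additive L -> k}) (alpha : L) :
    coordinate f0 -> nearly_coordinates (poly_xyz_z_xy f0) p d ->
    retraction iota rho ->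
  let fL := at_z _ alpha (map_mpoly (map_poly iota) (poly_xyz_z_xy f0)) in
  prime_elt fL /\ nonconstant fL.
Proof.
move=> coord [d0 inj im] ret.
apply: (fibre_prime (p := map_mpoly (map_poly iota) p) (d := map_poly iota d)).
  exact: coordinate_plane_fibre.
split; [by rewrite map_poly_eq0|exact: base_change_inj ret inj|].
move=> i; have [X EX] := im i; exists (map_mpoly (map_poly iota) X).
by rewrite -map_comp_mpoly2 -EX rmorphM /= map_mpolyC map_mpolyX.
Qed.

Lemma comp_mpoly2_poly (R : comNzRingType) (h : {poly R}) (f g q : {mpoly R[2]}) :
  polyev (@mpolyC 2 R) f h \mPo [tuple g; q] =
  polyev (@mpolyC 2 R) (f \mPo [tuple g; q]) h.
Proof.
apply: (poly_rmorph_eq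
  (f := comp_mpoly [tuple g; q] \o polyev (@mpolyC 2 R) f : {rmorphism _ -> _})
  (g := polyev (@mpolyC 2 R) (f \mPo [tuple g; q]))) => [c|].
  by rewrite [LHS]/= -/(polyev _ f _) !polyevC comp_mpolyC.
by rewrite [LHS]/= -/(polyev _ f _) !polyevX.
Qed.

Lemma map_mpoly_polyev (R S : comNzRingType) (n : nat) (ev : {rmorphism R -> S})
    (h : {poly R}) (f : {mpoly R[n]}) :
  map_mpoly ev (polyev (@mpolyC n R) f h) =
  polyev (@mpolyC n S) (map_mpoly ev f) (map_poly ev h).
Proof.
apply: (poly_rmorph_eq
  (f := map_mpoly ev \o polyev (@mpolyC n R) f : {rmorphism _ -> _})
  (g := polyev (@mpolyC n S) (map_mpoly ev f) \o map_poly ev : {rmorphism _ -> _})) => [c|].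
  by rewrite [LHS]/= [RHS]/= map_polyC -/(polyev _ _ _) !polyevC map_mpolyC.
by rewrite [LHS]/= [RHS]/= map_polyX -/(polyev _ _ _) !polyevX.
Qed.

Lemma mpoly2_ev_eq (R S : comNzRingType) (g h : {rmorphism {mpoly R[2]} -> S}) :
  (forall c, g c%:MP = h c%:MP) -> g 'X_ord0 = h 'X_ord0 ->
  g 'X_(lift ord0 ord0) = h 'X_(lift ord0 ord0) -> g =1 h.
Proof. by move=> eC e0 e1; apply: mpoly_rmorph_eq => //; apply: ord2_ind. Qed.

Lemma comp_mpoly2_id (R : comNzRingType) (q : {mpoly R[2]}) :
  q \mPo [tuple 'X_ord0; 'X_(lift ord0 ord0)] = q.
Proof.
apply: (mpoly2_ev_eq (g := comp_mpoly _) (h := idfun)) => [c||].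
- by rewrite /= comp_mpolyC.
- by rewrite /= comp_mpolyXU.
- by rewrite /= comp_mpolyXU.
Qed.

Lemma comp_mpoly2A (R : comNzRingType) (q a b f g : {mpoly R[2]}) :
  (q \mPo [tuple a; b]) \mPo [tuple f; g] =
  q \mPo [tuple a \mPo [tuple f; g]; b \mPo [tuple f; g]].
Proof.
apply: (mpoly2_ev_eq (g := comp_mpoly [tuple f; g] \o comp_mpoly [tuple a; b] : {rmorphism _ -> _})
  (h := comp_mpoly _)) => [c||].
- by rewrite /= !comp_mpolyC.
- by rewrite /= !comp_mpolyXU.
- by rewrite /= !comp_mpolyXU.
Qed.

(** The relation is moved from two-variable polynomials to k[s][t]. *)
Lemma mpoly_dependent_polynomial (k : fieldType) (f p q : {mpoly k[2]}) :
    nonconstant f ->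
    (forall (L : fieldType) (iota : {rmorphism k -> L})
        (rho : {additive L -> k}),
      retraction iota rho -> prime_elt (map_mpoly iota f)) ->
    q != 0 -> q \mPo [tuple f; p] = 0 ->
  exists h, p = polyev (@mpolyC 2 k) f h.
Proof.
move=> nc gprime q0 Eq.
have [w [wC wX]] := mpoly_hom (polyC \o polyC : {rmorphism k -> {poly {poly k}}})
  (tnth [tuple 'X%:P; 'X]).
have w0 : w 'X_ord0 = 'X%:P by rewrite wX.
have w1 : w 'X_(lift ord0 ord0) = 'X by rewrite wX (tnth_nth 0).
have rel_w g r q' : rel_ev g r (w q') = q' \mPo [tuple g; r].
  apply: (mpoly2_ev_eq (g := rel_ev g r \o w : {rmorphism _ -> _}) (h := comp_mpoly [tuple g; r])) => [c||].
  - by change (rel_ev g r (w c%:MP) = c%:MP \mPo [tuple g; r]); rewrite wC /rel_ev !polyevC comp_mpolyC.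
  - by change (rel_ev g r (w 'X_ord0) = 'X_ord0 \mPo [tuple g; r]); rewrite w0 /rel_ev polyevC polyevX comp_mpolyXU.
  - change (rel_ev g r (w 'X_(lift ord0 ord0)) = 'X_(lift ord0 ord0) \mPo [tuple g; r]).
    by rewrite w1 /rel_ev polyevX comp_mpolyXU.
apply: (dependent_polynomial nc gprime (H := w q)); last by rewrite rel_w.
by apply: contraNneq q0 => wq0; rewrite -(comp_mpoly2_id q) -rel_w wq0 rmorph0.
Qed.

Lemma affine_subst (R : comNzRingType) (q f p : {mpoly R[2]}) (h : {poly R}) (pi : R) :
  (q \mPo [tuple 'X_ord0; polyev (@mpolyC 2 R) 'X_ord0 h
                          + pi%:MP * 'X_(lift ord0 ord0)]) \mPo [tuple f; p] =
  q \mPo [tuple f; polyev (@mpolyC 2 R) f h + pi%:MP * p].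
Proof.
rewrite comp_mpoly2A rmorphD rmorphM /= comp_mpoly2_poly !comp_mpolyXU.
by rewrite comp_mpolyC.
Qed.

(** Algebraic independence of f and h(f) + pi p' implies that of f and p',
    since the affine substitution relating them is invertible after inverting
    pi. *)
Lemma affine_injective (R : idomainType) (f p' : {mpoly R[2]}) (h : {poly R}) (pi : R) :
    pi != 0 ->
    injective (comp_mpoly [tuple f; polyev (@mpolyC 2 R) f h + pi%:MP * p']) ->
  injective (comp_mpoly [tuple f; p']).
Proof.
move=> pi0 inj; pose X0 : {mpoly R[2]} := 'X_ord0; pose X1 : {mpoly R[2]} := 'X_(lift ord0 ord0).
set p := _ + _ in inj.
pose hX := polyev (@mpolyC 2 R) X0 h.
pose s := [tuple X0; hX + pi%:MP * X1].
have factor q : (q \mPo s) \mPo [tuple f; p'] = q \mPo [tuple f; p].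
  exact: affine_subst.
suff ker q : q \mPo [tuple f; p'] = 0 -> q = 0.
  move=> q q' Eq; apply/eqP; rewrite -subr_eq0; apply/eqP/ker.
  by rewrite rmorphB /= Eq subrr.
move=> Eq; have [||N [Y EY]] := denominators (sigma := comp_mpoly s) (d := pi) _ _ q.
- by move=> c; exists c%:MP; rewrite /= comp_mpolyC.
- apply: ord2_ind; first by exists (pi%:MP * X0); rewrite rmorphM /= comp_mpolyC comp_mpolyXU.
  exists (X1 - hX); rewrite rmorphB /= comp_mpoly2_poly !comp_mpolyXU /=.
  by rewrite addrC addKr.
have Y0 : Y = 0.
  by apply: inj; rewrite -factor -EY rmorphM /= Eq mulr0 rmorph0.
have : pi%:MP ^+ N * q == 0 by rewrite EY Y0 rmorph0.
by rewrite mulf_eq0 expf_eq0 mpolyC_eq0 (negPf pi0) andbF => /eqP.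
Qed.

(** Write d x = X(f,p) and d y = Y(f,p) with pi | d, and reduce modulo pi.  If X
    and Y vanish there, divide both by pi.  Otherwise f and p become
    algebraically dependent over the residue field, so p = h(f) there, that is
    p = h(f) + pi p' for some lift of h.  In terms of f and p', the relation
    X(f,p) becomes X(f, h(f) + pi p'), and modulo pi the polynomial
    X(s, h(s)) vanishes at f, which is not constant; so X(s, h(s) + pi t) is
    divisible by pi, and the same holds for Y. *)
Lemma divide_denominator (k : fieldType) (f0 : {mpoly k[3]})
    (p : {mpoly {poly k}[2]}) (pi d : {poly k}) :
    coordinate f0 -> irreducible_poly pi ->
    nearly_coordinates (poly_xyz_z_xy f0) p (pi * d) ->
  exists p', nearly_coordinates (poly_xyz_z_xy f0) p' d.
Proof.
move=> coord irr near; set f := poly_xyz_z_xy f0 in near *.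
have [pid0 inj im] := near.
have [pi0 d0] : pi != 0 /\ d != 0 by apply/andP; rewrite -negb_or -mulf_eq0.
have piM0 : pi%:MP != 0 :> {mpoly {poly k}[2]} by rewrite mpolyC_eq0.
have [L [ev [rho [ker surj ret]]]] := residue_field irr.
have kerev q : ev q = 0 -> dvdr pi q by move/ker.
have evpi : ev pi = 0 by apply/ker; exists 1; rewrite mulr1.
set iota : {rmorphism k -> L} := ev \o polyC in ret.
pose ev2 : {rmorphism {mpoly {poly k}[2]} -> {mpoly L[2]}} := map_mpoly ev.
have ev2C q : ev2 q%:MP = (ev q)%:MP by apply: map_mpolyC.
have ev2_comp q a b : ev2 (q \mPo [tuple a; b]) = ev2 q \mPo [tuple ev2 a; ev2 b].
  exact: map_comp_mpoly2.
have at_zE (M : fieldType) (iota' : {rmorphism L -> M}) a :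
    at_z 2 (iota' (ev 'X)) (map_mpoly (map_poly (iota' \o iota)) a)
    = map_mpoly iota' (ev2 a).
  apply/mpolyP => m; rewrite !mcoeff_map_mpoly /=.
  apply: (poly_rmorph_eq (f := polyev (@idfun M) (iota' (ev 'X)) \o map_poly (iota' \o iota) : {rmorphism _ -> _})
    (g := iota' \o ev : {rmorphism _ -> _})) => [c|] /=.
    by rewrite map_polyC -/(polyev _ _ _) polyevC.
  by rewrite map_polyX -/(polyev _ _ _) polyevX.
have gprime (M : fieldType) (iota' : {rmorphism L -> M}) (rho' : {additive M -> L}) :
    retraction iota' rho' ->
    prime_elt (map_mpoly iota' (ev2 f)) /\ nonconstant (map_mpoly iota' (ev2 f)).
  move=> ret'; rewrite -at_zE.
  exact: fibre_over coord near (retraction_comp ret ret').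
have nc : nonconstant (ev2 f).
  move=> c Ec; have [|_ nc] := gprime L idfun idfun; first by [].
  by apply: (nc c); rewrite Ec map_mpolyC.
have [X0 EX0] := im ord0; have [X1 EX1] := im (lift ord0 ord0).
have reduce (p' : {mpoly {poly k}[2]}) i X :
    (pi * d)%:MP * 'X_i = X \mPo [tuple f; p'] -> ev2 X = 0 ->
    exists X', d%:MP * 'X_i = X' \mPo [tuple f; p'].
  move=> EX /(mpoly_dvd_kernel kerev)[X' EX']; exists X'; apply: (mulfI piM0).
  by rewrite mulrA -mpolyCM EX EX' rmorphM /= comp_mpolyC.
have [[Z0 Z1]|[i [X [EX NX]]]] : (ev2 X0 = 0 /\ ev2 X1 = 0) \/
    exists i X, (pi * d)%:MP * 'X_i = X \mPo [tuple f; p] /\ ev2 X != 0.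
- have [Z0|N0] := eqVneq (ev2 X0) 0; last first.
    by right; exists ord0, X0; split; [exact: EX0|exact: N0].
  have [Z1|N1] := eqVneq (ev2 X1) 0; last first.
    by right; exists (lift ord0 ord0), X1; split; [exact: EX1|exact: N1].
  by left.
- exists p; split=> //; apply: ord2_ind; first exact: reduce EX0 Z0.
  exact: reduce EX1 Z1.
have vanish j Y : (pi * d)%:MP * 'X_j = Y \mPo [tuple f; p] ->
    ev2 Y \mPo [tuple ev2 f; ev2 p] = 0.
  by move=> EY; rewrite -ev2_comp -EY rmorphM ev2C rmorphM evpi mul0r mpolyC0 mul0r.
have [hL EhL] : exists h, ev2 p = polyev (@mpolyC 2 L) (ev2 f) h.
  apply: mpoly_dependent_polynomial nc _ NX (vanish _ _ EX) => M iota' rho' ret'.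
  exact: (gprime _ _ _ ret').1.
have [h Eh] := surjective_map_poly surj hL.
have [p' Ep'] : dvdr pi%:MP (p - polyev (@mpolyC 2 {poly k}) f h).
  apply: mpoly_dvd_kernel kerev _; rewrite rmorphB /= map_mpoly_polyev Eh.
  by rewrite -[map_mpoly ev p]/(ev2 p) EhL subrr.
have Ep : p = polyev (@mpolyC 2 {poly k}) f h + pi%:MP * p'.
  by rewrite -Ep' addrC subrK.
have inj' : injective (comp_mpoly [tuple f; p']).
  by move: inj; rewrite Ep; apply: affine_injective.
exists p'; split; [exact: d0|exact: inj'|move=> j].
have [Y EY] := im j.
pose hX := polyev (@mpolyC 2 {poly k}) 'X_ord0 h.
pose s := [tuple 'X_ord0; hX + pi%:MP * 'X_(lift ord0 ord0)].
apply: (reduce p' j (Y \mPo s)).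
  have -> : Y \mPo s \mPo [tuple f; p'] = Y \mPo [tuple f; p]; last exact: EY.
  by rewrite [in RHS]Ep; apply: affine_subst.
(* The map kap sends q(s,t) to q(s, h(s)), with h reduced modulo pi. *)
have [kap [kapC kapX]] := mpoly_hom (@polyC L) (tnth [tuple 'X; hL]).
have kapE g q : q \mPo [tuple g; polyev (@mpolyC 2 L) g hL] = polyev (@mpolyC 2 L) g (kap q).
  apply: (mpoly2_ev_eq (g := comp_mpoly _) (h := polyev (@mpolyC 2 L) g \o kap : {rmorphism _ -> _})) => [c||].
  - change (c%:MP \mPo [tuple g; polyev (@mpolyC 2 L) g hL] = polyev (@mpolyC 2 L) g (kap c%:MP)).
    by rewrite kapC polyevC comp_mpolyC.
  - change ('X_ord0 \mPo [tuple g; polyev (@mpolyC 2 L) g hL] = polyev (@mpolyC 2 L) g (kap 'X_ord0)).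
    by rewrite kapX polyevX comp_mpolyXU.
  - change ('X_(lift ord0 ord0) \mPo [tuple g; polyev (@mpolyC 2 L) g hL] = polyev (@mpolyC 2 L) g (kap 'X_(lift ord0 ord0))).
    by rewrite kapX comp_mpolyXU.
have kap0 : kap (ev2 Y) = 0.
  by apply: (polyev_nonconstant nc); rewrite -kapE -EhL (vanish _ _ EY).
rewrite ev2_comp rmorphD rmorphM ev2C evpi mpolyC0 mul0r addr0.
rewrite -[ev2 hX]/(map_mpoly ev hX) map_mpoly_polyev Eh.
by rewrite -/ev2 kapE kap0 rmorph0.
Qed.

(** When d is a constant, x and y are polynomials in f and p, and the
    substitution is an injective endomorphism that reaches all variables. *)
Lemma nearly_coordinates_coordinate (k : fieldType) (f0 : {mpoly k[3]})
    (p : {mpoly {poly k}[2]}) (d : {poly k}) :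
  coordinate f0 -> nearly_coordinates (poly_xyz_z_xy f0) p d ->
  coordinate (poly_xyz_z_xy f0).
Proof.
move=> coord; have [n] := ubnP (size d).
elim: n d p => // n IHn d p lt_n near.
have [d0 inj im] := near.
have [le1|gt1] := leqP (size d) 1; last first.
  have [pi [irr [d' Ed]]] := irreducible_factor gt1.
  rewrite Ed in near; have [p' near'] := divide_denominator coord irr near.
  have [d'0 _ _] := near'; apply: IHn near'.
  move: lt_n irr.1; rewrite Ed size_mul //; last first.
    by apply: contraNneq d0 => pi0; rewrite Ed pi0 mul0r.
  case: (size pi) => [|[|m]] //; rewrite !addSn /= ltnS => lt_n _.
  by apply: leq_trans lt_n; rewrite ltnS leq_addl.
have Ed := size1_polyC le1.
have dN0 : d`_0 != 0 by apply: contraNneq d0 => h; rewrite Ed h.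
have gen i : exists X, 'X_i = X \mPo [tuple poly_xyz_z_xy f0; p].
  have [X EX] := im i; exists ((d`_0)^-1%:P%:MP * X).
  rewrite rmorphM /= comp_mpolyC -EX mulrA -mpolyCM {2}Ed -polyCM mulVf //.
  by rewrite mpolyC1 mul1r.
have [Y0 EY0] := gen ord0; have [Y1 EY1] := gen (lift ord0 ord0).
exists [tuple p].
have canK q : (q \mPo [tuple Y0; Y1]) \mPo [tuple poly_xyz_z_xy f0; p] = q.
  by rewrite comp_mpoly2A -EY0 -EY1 comp_mpoly2_id.
have -> : [tuple of poly_xyz_z_xy f0 :: [tuple p]] = [tuple poly_xyz_z_xy f0; p].
  by apply: val_inj.
exists (comp_mpoly [tuple Y0; Y1]) => q; last exact: canK.
apply: inj; exact: canK.
Qed.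

(** * From the fraction field to denominators *)

Lemma fraction_clear (R : idomainType) (x : {fraction R}) :
  exists d a, d != 0 /\ tofrac d * x = tofrac a.
Proof.
elim/quotW: x => -[[a d] /= d0]; exists d, a; split=> //.
unlock tofrac; rewrite -[LHS]FracField.pi_mul; apply/eqmodP.
by rewrite /= FracField.equivfE /FracField.mulf /= !numden_Ratio ?oner_neq0 ?mul1r ?mulr1 //= mulrC.
Qed.

Lemma scale_subst (R : comNzRingType) (c : R) (q a b : {mpoly R[2]}) :
  (q \mPo [tuple 'X_ord0; c%:MP * 'X_(lift ord0 ord0)]) \mPo [tuple a; b] =
  q \mPo [tuple a; c%:MP * b].
Proof. by rewrite comp_mpoly2A rmorphM /= !comp_mpolyXU comp_mpolyC. Qed.

Section Denominators.

Variables (R : idomainType) (K : fieldType) (j : {rmorphism R -> K}).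
Hypothesis j_inj : injective j.
Hypothesis j_clear : forall x, exists d a, d != 0 /\ j d * x = j a.

Lemma mpoly_clear (n : nat) (q : {mpoly K[n]}) :
  exists d a, d != 0 /\ (j d)%:MP * q = map_mpoly j a.
Proof.
elim/mpoly_ring_ind: q => [x|i|q q' [d [a [d0 E]]] [d' [a' [d'0 E']]]|q q' [d [a [d0 E]]] [d' [a' [d'0 E']]]].
- have [d [a [d0 E]]] := j_clear x; exists d, a%:MP.
  by rewrite map_mpolyC -mpolyCM E.
- by exists 1, 'X_i; rewrite oner_neq0 rmorph1 mpolyC1 mul1r map_mpolyX.
- exists (d * d'), (d'%:MP * a + d%:MP * a'); split; first exact: mulf_neq0.
  rewrite (rmorphM j) mpolyCM rmorphD /= 2!(rmorphM (map_mpoly _)) /= !map_mpolyC.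
  by rewrite -E -E' mulrDr; rewrite [_ * (_ * q)]mulrCA !mulrA.
exists (d * d'), (a * a'); split; first exact: mulf_neq0.
by rewrite (rmorphM j) mpolyCM (rmorphM (map_mpoly _)) /= -E -E' mulrACA.
Qed.

(** If (f, g) is a coordinate system over the fraction field and e is a
    denominator of g, then so is (f, e g).  Its injectivity restricts to R, and
    clearing the denominators of the inverse gives d. *)
Lemma coordinate_denominators (f : {mpoly R[2]}) :
  coordinate (map_mpoly j f) ->
  exists p d, nearly_coordinates f p d.
Proof.
pose io : {rmorphism {mpoly R[2]} -> {mpoly K[2]}} := map_mpoly j.
have io_inj : injective io.
  have ioE a m : (io a)@_m = j a@_m by apply: mcoeff_map_mpoly.
  by move=> a b Eab; apply/mpolyP => m; apply: j_inj; rewrite -!ioE Eab.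
have io_comp q a b : io (q \mPo [tuple a; b]) = io q \mPo [tuple io a; io b].
  exact: map_comp_mpoly2.
have ioC c : io c%:MP = (j c)%:MP by apply: map_mpolyC.
have ioX i : io 'X_i = 'X_i by apply: map_mpolyX.
case=> g; rewrite -[map_mpoly j f]/(io f).
have -> : [tuple of io f :: g] = [tuple io f; tnth g ord0].
  apply: eq_from_tnth; apply: ord2_ind => //.
  by rewrite tnthS [RHS](tnth_nth 0).
move: (tnth g ord0) => {}g [inv invK Kinv].
have [e [p [e0 Ep]]] := mpoly_clear g.
have eK0 : j e != 0 by rewrite -(rmorph0 j) (inj_eq j_inj).
pose sc (c : K) (q : {mpoly K[2]}) : {mpoly K[2]} := q \mPo [tuple 'X_ord0; c%:MP * 'X_(lift ord0 ord0)].
have gE q : q \mPo [tuple io f; io p] = sc (j e) q \mPo [tuple io f; g].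
  by rewrite scale_subst Ep.
have scK c q : c != 0 -> sc c^-1 (sc c q) = q.
  move=> c0; rewrite /sc scale_subst mulrA -mpolyCM divff // mpolyC1 mul1r.
  exact: comp_mpoly2_id.
have inj : injective (comp_mpoly [tuple f; p]).
  move=> q q' /(congr1 io); rewrite !io_comp !gE => /(can_inj invK).
  by move/(congr1 (sc (j e)^-1)); rewrite !scK // => /io_inj.
have gen i : exists d X, d != 0 /\ d%:MP * 'X_i = X \mPo [tuple f; p].
  have [d [X [d0 EX]]] := mpoly_clear (sc (j e)^-1 (inv 'X_i)).
  exists d, X; split=> //; apply: io_inj; rewrite io_comp rmorphM ioC ioX.
  rewrite -[io X]EX rmorphM /= comp_mpolyC; congr (_ * _).
  by rewrite gE -{1}[j e]invrK scK ?invr_eq0 // Kinv.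
have [d0 [X0 [d00 EX0]]] := gen ord0.
have [d1 [X1 [d10 EX1]]] := gen (lift ord0 ord0).
exists p, (d0 * d1); split; [exact: mulf_neq0|exact: inj|apply: ord2_ind].
  exists (d1%:MP * X0).
  by rewrite (rmorphM (comp_mpoly _)) /= comp_mpolyC -EX0 mulrA -mpolyCM [d1 * _]mulrC.
exists (d0%:MP * X1).
by rewrite (rmorphM (comp_mpoly _)) /= comp_mpolyC -EX1 mulrA -mpolyCM.
Qed.

End Denominators.

Theorem mainTheorem2 (k : fieldType) (f : {mpoly k[3]}) :
  [pchar k] =i pred0 ->
  coordinate f ->
  coordinate (poly_z_xy_frac (poly_xyz_z_xy f)) ->
  coordinate (poly_xyz_z_xy f).
Proof.
move=> _ coord generic.
have tofrac_inj : injective (@tofrac {poly k}).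
  by move=> a b /eqP; rewrite tofrac_eq => /eqP.
have [p [d near]] := coordinate_denominators tofrac_inj (@fraction_clear _) generic.
exact: nearly_coordinates_coordinate coord near.
Qed.
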